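(* Let $F\in\widehat{\mathrm{Diff}}(\mathbb C^n,0)$ and let $m$ be the index of embeddability of $F$. Let $X$ be an infinitesimal generator of $F^m$. Given an ideal $I$ of $\hat{\mathcal O}_n$, the following properties are equivalent: (1) $I$ is invariant for $X$; (2) $I$ is invariant for $F^m$; (3) $I$ is invariant for a non-trivial iterate of $F$.
   Context: Let $\hat{\mathcal O}_n=\mathbb C[[x_1,\dots,x_n]]$ with maximal ideal $\mathfrak m$. $\widehat{\mathrm{Diff}}(\mathbb C^n,0)$ is the group (under composition) of formal diffeomorphisms, i.e. $n$-tuples $F\in\mathfrak m^n$ with invertible linear part. $\hat{\mathfrak X}(\mathbb C^n,0)$ is the Lie algebra of singular formal vector fields $X=\sum a_j\,\partial/\partial x_j$, $a_j\in\mathfrak m$. $\mathrm{Exp}(X)$ is given by $g\circ\mathrm{Exp}(X)=\sum_{j\ge0}X^j(g)/j!$ for $g\in\hat{\mathcal O}_n$. An ideal $I\subset\hat{\mathcal O}_n$ is invariant for $F$ if $I\circ F=\{g\circ F:g\in I\}\subset I$, and invariant for $X$ if $X(I)\subset I$. A non-trivial iterate of $F$ is $F^r$ with $r\in\mathbb Z\setminus\{0\}$. For $k\ge1$, let $\pi_k(F)\in GL(\mathfrak m/\mathfrak m^{k+1})$ be the map $f+\mathfrak m^{k+1}\mapsto f\circ F+\mathfrak m^{k+1}$ and $D_k=\pi_k(\widehat{\mathrm{Diff}}(\mathbb C^n,0))$, an algebraic matrix group; let $d\pi_k(X)$ be the derivation of $\mathfrak m/\mathfrak m^{k+1}$ induced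 by $X$. For a subgroup $G$ of $\widehat{\mathrm{Diff}}(\mathbb C^n,0)$, let $G_k$ be the Zariski closure of $\pi_k(G)$ and $\mathfrak g_k$ its Lie algebra; put $\overline G=\{F:\pi_k(F)\in G_k\ \forall k\ge1\}$, with Lie algebra $\mathfrak g=\{X:d\pi_k(X)\in\mathfrak g_k\ \forall k\ge1\}$. $X$ is an infinitesimal generator of $F$ if $F=\mathrm{Exp}(X)$ and $X$ belongs to the Lie algebra of $\overline{\langle F\rangle}$. The index of embeddability of $F$ is the minimum $m\ge1$ such that $F^m$ has an infinitesimal generator (it exists by a theorem of Binyamini). *)

(* Defs.v *)
From HB Require Import structures.
From mathcomp Require Import all_boot all_order all_algebra.
From mathcomp Require Import complex.
From mathcomp Require Import all_classical all_reals.
From mathcomp Require mpoly ssrcomplements.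
(* The notations of mpoly clash with those of mathcomp-analysis: [multinom n]
   (multi-indices), [mnm_add], [mnm1 i], [mdeg], [bmultinom n k] (multi-indices
   of degree < k), [mpoly n K], [meval], [mderiv] are used by name. *)
Import -(notations) mpoly.
From mathcomp Require Import topology normedtype sequences.
Import numFieldNormedType.Exports.

Set Implicit Arguments.
Unset Strict Implicit.
Unset Printing Implicit Defensive.

Import Order.TTheory GRing.Theory Num.Theory.
Local Open Scope ring_scope.

Local Infix "+m" := mnm_add (at level 50, left associativity).

Record fps (n : nat) (K : Type) := FPS { fcoef :> multinom n -> K }.

HB.instance Definition _ n K := [isNew for @fcoef n K].
HB.instance Definition _ n (K : choiceType) := [Choice of fps n K by <:].

Section Fps.
Variables (n : nat) (K : fieldType).
Implicit Types (f g h : fps n K) (m : multinom n) (c : K).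

Lemma fpsP f g : f =1 g -> f = g.
Proof. by move=> fg; apply: val_inj; apply: funext. Qed.

Definition fps0 : fps n K := FPS (fun=> 0).
Definition fps_opp f : fps n K := FPS (fun m => - f m).
Definition fps_add f g : fps n K := FPS (fun m => f m + g m).

Fact fps_addA : associative fps_add.
Proof. by move=> f g h; apply: fpsP => m /=; rewrite addrA. Qed.
Fact fps_addC : commutative fps_add.
Proof. by move=> f g; apply: fpsP => m /=; rewrite addrC. Qed.
Fact fps_add0 : left_id fps0 fps_add.
Proof. by move=> f; apply: fpsP => m /=; rewrite add0r. Qed.
Fact fps_addN : left_inverse fps0 fps_opp fps_add.
Proof. by move=> f; apply: fpsP => m /=; rewrite addNr. Qed.

HB.instance Definition _ :=
  GRing.isZmodule.Build (fps n K) fps_addA fps_addC fps_add0 fps_addN.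

Lemma fps0E m : (0 : fps n K) m = 0. Proof. by []. Qed.
Lemma fpsDE f g m : (f + g) m = f m + g m. Proof. by []. Qed.
Lemma fpsNE f m : (- f) m = - f m. Proof. by []. Qed.
Lemma fpsBE f g m : (f - g) m = f m - g m. Proof. by []. Qed.
Lemma fps_sumE I (r : seq I) (P : pred I) (F : I -> fps n K) m :
  (\sum_(i <- r | P i) F i) m = \sum_(i <- r | P i) F i m.
Proof. exact: (big_morph (fun f : fps n K => f m)). Qed.

Definition fps_mul f g : fps n K := FPS (fun m =>
  \sum_(k : bmultinom n (mdeg m).+1 * bmultinom n (mdeg m).+1
        | m == bmnm k.1 +m bmnm k.2) f k.1 * g k.2).

Definition fps_monom m : fps n K := FPS (fun m' => (m == m')%:R).
Definition fpsC c : fps n K := FPS (fun m => c * (m == mnm0)%:R).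

Definition eqtrunc k f g := forall m, (mdeg m < k)%N -> f m = g m.

Definition of_mpoly (p : mpoly n K) : fps n K := FPS (fun m => mcoeff m p).

Definition trunc k f : mpoly n K :=
  \sum_(m : bmultinom n k) f m *: mpolyX K m.

Lemma mcoeff_trunc k f m :
  mcoeff m (trunc k f) = if (mdeg m < k)%N then f m else 0.
Proof.
rewrite /trunc raddf_sum /=; case: ifPn => [km|km].
  rewrite (bigD1 (BMultinom km)) //= mcoeffZ mcoeffX eqxx mulr1 big1 ?addr0 // => b.
  by rewrite mcoeffZ mcoeffX -val_eqE /= => /negPf ->; rewrite mulr0.
rewrite big1 // => b _; rewrite mcoeffZ mcoeffX; case: eqP => [bm|]; last by rewrite mulr0.
by move: km; rewrite -bm bmdeg.
Qed.

Lemma truncP k f : eqtrunc k f (of_mpoly (trunc k f)).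
Proof. by move=> m km /=; rewrite mcoeff_trunc km. Qed.

Lemma eqtrunc_sym k f g : eqtrunc k f g -> eqtrunc k g f.
Proof. by move=> fg m km; rewrite fg. Qed.

Lemma eqtrunc_trans k f g h : eqtrunc k f g -> eqtrunc k g h -> eqtrunc k f h.
Proof. by move=> fg gh m km; rewrite fg ?gh. Qed.

Lemma eqtruncP f g : (forall k, eqtrunc k f g) -> f = g.
Proof. by move=> fg; apply: fpsP => m; apply: (fg (mdeg m).+1). Qed.

Lemma eqtrunc_mul k f f' g g' : eqtrunc k f f' -> eqtrunc k g g' ->
  eqtrunc k (fps_mul f g) (fps_mul f' g').
Proof.
move=> ff gg m km /=; apply: eq_bigr => -[/= b1 b2] /eqP/(congr1 mdeg); rewrite mdegD => mb.
by rewrite ff ?gg // (leq_ltn_trans _ km) //= [leqRHS]mb ?leq_addr ?leq_addl.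
Qed.

Lemma of_mpolyM p q : of_mpoly (p * q) = fps_mul (of_mpoly p) (of_mpoly q).
Proof. by apply: fpsP => m /=; rewrite mcoeffM. Qed.

Lemma of_mpoly1 : of_mpoly 1 = fpsC 1.
Proof. by apply: fpsP => m /=; rewrite mcoeff1 mul1r. Qed.

Let trunc_mul k f g :
  eqtrunc k (fps_mul f g) (of_mpoly (trunc k f * trunc k g)).
Proof. by rewrite of_mpolyM; apply: eqtrunc_mul; apply: truncP. Qed.

Fact fps_mulA : associative fps_mul.
Proof.
move=> f g h; apply: eqtruncP => k.
apply: (@eqtrunc_trans _ _ (of_mpoly (trunc k f * (trunc k g * trunc k h)))).
  by rewrite of_mpolyM; apply: eqtrunc_mul; [apply: truncP|apply: trunc_mul].
rewrite mulrA of_mpolyM; apply/eqtrunc_sym/eqtrunc_mul; last exact: truncP.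
exact: trunc_mul.
Qed.

Fact fps_mulC : commutative fps_mul.
Proof.
move=> f g; apply: eqtruncP => k; apply: (eqtrunc_trans (trunc_mul _ _)).
by rewrite mulrC; apply/eqtrunc_sym/trunc_mul.
Qed.

Fact fps_mul1 : left_id (fpsC 1) fps_mul.
Proof.
move=> f; apply: eqtruncP => k.
apply: (@eqtrunc_trans _ _ (of_mpoly (1 * trunc k f))).
  by rewrite of_mpolyM -of_mpoly1; apply: eqtrunc_mul => //; apply: truncP.
by rewrite mul1r; apply/eqtrunc_sym/truncP.
Qed.

Fact fps_mulDl : left_distributive fps_mul +%R.
Proof.
move=> f g h; apply: fpsP => m; rewrite fpsDE /= -big_split /=.
by apply: eq_bigr => b _; rewrite mulrDl.
Qed.

Fact fps_oner_neq0 : fpsC 1 != 0.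
Proof.
apply/eqP => /(congr1 (fun f : fps n K => f (mnm0))) /= /eqP.
by rewrite eqxx mulr1 oner_eq0.
Qed.

HB.instance Definition _ := GRing.Zmodule_isComNzRing.Build (fps n K)
  fps_mulA fps_mulC fps_mul1 fps_mulDl fps_oner_neq0.

Definition fps_scale c f : fps n K := FPS (fun m => c * f m).

Fact fps_scaleA c d f : fps_scale c (fps_scale d f) = fps_scale (c * d) f.
Proof. by apply: fpsP => m /=; rewrite mulrA. Qed.
Fact fps_scale1 : left_id 1 fps_scale.
Proof. by move=> f; apply: fpsP => m /=; rewrite mul1r. Qed.
Fact fps_scaleDr : right_distributive fps_scale +%R.
Proof. by move=> c f g; apply: fpsP => m /=; rewrite mulrDr. Qed.
Fact fps_scaleDl f : {morph fps_scale^~ f : c d / c + d}.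
Proof. by move=> c d; apply: fpsP => m /=; rewrite mulrDl. Qed.

HB.instance Definition _ := GRing.Zmodule_isLmodule.Build K (fps n K)
  fps_scaleA fps_scale1 fps_scaleDr fps_scaleDl.

Fact fps_scaleAl c f g : c *: (f * g) = (c *: f) * g.
Proof.
apply: fpsP => m /=; rewrite mulr_sumr.
by apply: eq_bigr => b _; rewrite mulrA.
Qed.

HB.instance Definition _ := GRing.Lmodule_isLalgebra.Build K (fps n K) fps_scaleAl.

Lemma fpsZE c f m : (c *: f) m = c * f m. Proof. by []. Qed.
Lemma fpsME f g m : (f * g) m =
  \sum_(k : bmultinom n (mdeg m).+1 * bmultinom n (mdeg m).+1
        | m == bmnm k.1 +m bmnm k.2) f k.1 * g k.2.
Proof. by []. Qed.

Definition fpsX i : fps n K := fps_monom (mnm1 i).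

(* The maximal ideal: zero constant term. *)
Definition in_maxideal f := f mnm0 = 0.

(* g o F, where F is a tuple of elements of the maximal ideal.  The series
   \sum_b g_b F^b is finite in each degree: F^b has order at least the degree
   of b, so that only the b with deg b <= deg m contribute to the coefficient
   of index m (see [comp_bound]). *)
Definition fps_comp g (F : 'I_n -> fps n K) : fps n K := FPS (fun m =>
  \sum_(b : bmultinom n (mdeg m).+1) g b * (\prod_i F i ^+ bmnm b i) m).

Local Notation vanish F := (forall i, in_maxideal (F i)).

Let order_ge k f := eqtrunc k f 0.

Lemma order_geM j k f g : order_ge j f -> order_ge k g -> order_ge (j + k) (f * g).
Proof.
move=> oj ok m mjk; rewrite fpsME big1 // => -[/= b1 b2] /eqP/(congr1 mdeg).
rewrite mdegD => mb; case: (ltnP (mdeg b1) j) => [/oj -> |b1j]; first by rewrite mul0r.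
case: (ltnP (mdeg b2) k) => [/ok -> |b2k]; first by rewrite mulr0.
by move: mjk; rewrite [X in (X < _)%N]mb ltnNge leq_add.
Qed.

Lemma order_ge1 f : in_maxideal f -> order_ge 1 f.
Proof. by move=> f0 m; rewrite ltnS leqn0 mdeg_eq0 => /eqP ->. Qed.

Lemma order_geX k f : in_maxideal f -> order_ge k (f ^+ k).
Proof.
move=> f0; elim: k => [//|k IH]; rewrite exprS -add1n.
by apply: order_geM => //; exact: order_ge1.
Qed.

Lemma order_monom (F : 'I_n -> fps n K) m :
  vanish F -> order_ge (mdeg m) (\prod_i F i ^+ m i).
Proof.
move=> F0; rewrite mdegE; elim/big_rec2: _ => [//|i f k _ IH].
by apply: order_geM => //; exact: order_geX.
Qed.

Lemma comp_bound g F m k : vanish F -> (mdeg m < k)%N ->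
  fps_comp g F m = \sum_(b : bmultinom n k) g b * (\prod_i F i ^+ bmnm b i) m.
Proof.
move=> F0 mk; rewrite /= [RHS](bigID (fun b : bmultinom n k => mdeg b < (mdeg m).+1)%N) /=.
rewrite [X in _ = _ + X]big1 ?addr0 => [|b]; last first.
  by rewrite -leqNgt => mb; rewrite order_monom ?mulr0.
rewrite (@ssrcomplements.big_sub_widen _ _ _ _ (fun b => mdeg b < (mdeg m).+1)%N
  (fun b => mdeg b < k)%N (bmultinom n (mdeg m).+1) (bmultinom n k) xpredT
  (fun b : multinom n => g b * (\prod_i F i ^+ b i) m)) //=.
by move=> b; rewrite ltnS => /leq_ltn_trans; apply.
Qed.

Lemma compD F : {morph fps_comp^~ F : g h / g + h}.
Proof.
move=> g h; apply: fpsP => m; rewrite fpsDE /= -big_split /=.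
by apply: eq_bigr => b _; rewrite mulrDl.
Qed.

Lemma comp0 F : fps_comp 0 F = 0.
Proof. by apply: fpsP => m /=; rewrite big1 // => b _; rewrite mul0r. Qed.

Lemma compZ F c g : fps_comp (c *: g) F = c *: fps_comp g F.
Proof.
apply: fpsP => m; rewrite fpsZE /= mulr_sumr.
by apply: eq_bigr => b _; rewrite mulrA.
Qed.

Lemma comp_trunc k F g h : eqtrunc k g h -> eqtrunc k (fps_comp g F) (fps_comp h F).
Proof.
move=> gh m mk /=; apply: eq_bigr => b _; rewrite gh //.
by apply: leq_ltn_trans mk; rewrite -ltnS bmdeg.
Qed.

Local Notation ev F := (mmap (GRing.in_alg (fps n K)) F).

Lemma comp_of_mpoly F p : vanish F -> fps_comp (of_mpoly p) F = ev F p.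
Proof.
move=> F0; apply: fpsP => m.
rewrite (@comp_bound _ _ _ (maxn (mmeasure (mdeg (n := n)) p) (mdeg m).+1)) ?leq_maxr //.
rewrite (@mmapE _ _ _ _ _ _ (maxn (mmeasure (mdeg (n := n)) p) (mdeg m).+1)) ?leq_maxl //.
by rewrite fps_sumE; apply: eq_bigr => b _; rewrite mulr_algl.
Qed.

Lemma comp_evP k F g : vanish F -> eqtrunc k (fps_comp g F) (ev F (trunc k g)).
Proof. by move=> F0; rewrite -comp_of_mpoly //; apply: comp_trunc; apply: truncP. Qed.

Lemma compM F : vanish F -> {morph fps_comp^~ F : g h / g * h}.
Proof.
move=> F0 g h; apply: eqtruncP => k.
apply: (@eqtrunc_trans _ _ (fps_comp (of_mpoly (trunc k g * trunc k h)) F)).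
  exact/comp_trunc/trunc_mul.
rewrite comp_of_mpoly // rmorphM /=.
by apply/eqtrunc_sym/eqtrunc_mul; apply: comp_evP.
Qed.

Lemma comp1 F : vanish F -> fps_comp 1 F = 1.
Proof. by move=> F0; rewrite -[1 in LHS]of_mpoly1 comp_of_mpoly // rmorph1. Qed.

Lemma compX F g k : vanish F -> fps_comp (g ^+ k) F = fps_comp g F ^+ k.
Proof.
by move=> F0; elim: k => [|k IH]; rewrite ?expr0 ?comp1 // !exprS compM // IH.
Qed.

Lemma comp_maxideal g F : in_maxideal g -> vanish F -> in_maxideal (fps_comp g F).
Proof.
move=> g0 F0; rewrite /in_maxideal (@comp_bound _ _ _ 1) ?mdeg0 // big1 // => b _.
have /eqP : mdeg b = 0%N by apply/eqP; rewrite -leqn0 -ltnS bmdeg.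
by rewrite mdeg_eq0 => /eqP ->; rewrite g0 mul0r.
Qed.

Lemma compA g F G : vanish F -> vanish G ->
  fps_comp g (fun i => fps_comp (F i) G) = fps_comp (fps_comp g F) G.
Proof.
move=> F0 G0; have FG0 : vanish (fun i => fps_comp (F i) G).
  by move=> i; apply: comp_maxideal.
apply: eqtruncP => k; apply: (eqtrunc_trans (comp_evP _ FG0)).
apply: (@eqtrunc_trans _ _ (fps_comp (ev F (trunc k g)) G)); last first.
  exact/eqtrunc_sym/comp_trunc/comp_evP.
move=> m _; congr (fcoef _ m); rewrite /mmap (big_morph _ (compD G) (comp0 G)).
apply: eq_bigr => b _; rewrite compM // !mulr_algl compZ comp1 // mulr_algl.
congr (_ *: _); rewrite /mmap1 (big_morph _ (compM G0) (comp1 G0)).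
by apply: eq_bigr => i _; rewrite compX.
Qed.

Lemma fpsX_of_mpoly i : fpsX i = of_mpoly (mpolyX K (mnm1 i)).
Proof. by apply: fpsP => m /=; rewrite mcoeffX. Qed.

Lemma fpsX_maxideal i : in_maxideal (fpsX i).
Proof. by rewrite /in_maxideal /= mnm1_eq0. Qed.

Lemma comp_fpsX F i : vanish F -> fps_comp (fpsX i) F = F i.
Proof. by move=> F0; rewrite fpsX_of_mpoly comp_of_mpoly // mmapX mmap1U. Qed.

Lemma fps_monomE m : fps_monom m = \prod_i fpsX i ^+ m i :> fps n K.
Proof.
have -> : fps_monom m = of_mpoly (mpolyX K m) by apply: fpsP => m' /=; rewrite mcoeffX.
rewrite mpolyXE_id (big_morph _ of_mpolyM of_mpoly1); apply: eq_bigr => i _.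
by elim: (m i) => [|k IH]; rewrite ?expr0 ?of_mpoly1 // !exprS of_mpolyM IH fpsX_of_mpoly.
Qed.

Lemma comp_id g : fps_comp g fpsX = g.
Proof.
apply: fpsP => m /=; rewrite (bigD1 (BMultinom (leqnn (mdeg m).+1))) //=.
rewrite -fps_monomE /= eqxx mulr1 big1 ?addr0 // => b.
by rewrite -fps_monomE -val_eqE /= => /negPf ->; rewrite mulr0.
Qed.

Lemma compB F : {morph fps_comp^~ F : g h / g - h}.
Proof. by move=> g h; rewrite compD -scaleN1r compZ scaleN1r. Qed.

Lemma comp_sum F I (r : seq I) (P : pred I) (g : I -> fps n K) :
  fps_comp (\sum_(i <- r | P i) g i) F = \sum_(i <- r | P i) fps_comp (g i) F.
Proof. exact: (big_morph _ (compD F) (comp0 F)). Qed.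

Definition jacobian (F : 'I_n -> fps n K) : 'M[K]_n :=
  \matrix_(i, j) F i (mnm1 j).

Let lin f : fps n K := \sum_l f (mnm1 l) *: fpsX l.

Let lin_rest f : in_maxideal f -> order_ge 2 (f - lin f).
Proof.
move=> f0 m; rewrite ltnS leq_eqVlt ltnS leqn0 => /orP[/mdeg1P[i /eqP ->]|].
  rewrite fpsBE fps_sumE (bigD1 i) //= eqxx mulr1 big1 ?addr0 ?subrr // => l li.
  by rewrite eq_mnm1 (negPf li) mulr0.
rewrite mdeg_eq0 => /eqP ->; rewrite fpsBE f0 fps_sumE big1 ?subrr // => l _.
by rewrite fpsZE fpsX_maxideal mulr0.
Qed.

Let comp_lin f G : vanish G -> fps_comp (lin f) G = \sum_l f (mnm1 l) *: G l.
Proof.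
by move=> G0; rewrite comp_sum; apply: eq_bigr => l _; rewrite compZ comp_fpsX.
Qed.

Lemma jacobian_comp F G : vanish F -> vanish G ->
  jacobian (fun i => fps_comp (F i) G) = jacobian F *m jacobian G.
Proof.
move=> F0 G0; apply/matrixP => i j; rewrite !mxE.
rewrite -{1}[F i](subrK (lin (F i))) compD fpsDE.
rewrite (@comp_trunc 2 G _ 0) ?mdeg1 //; last exact: lin_rest.
rewrite comp0 add0r comp_lin // fps_sumE.
by apply: eq_bigr => l _; rewrite !mxE.
Qed.

Lemma jacobian_id : jacobian fpsX = 1%:M.
Proof. by apply/matrixP => i j; rewrite !mxE /= eq_mnm1. Qed.

Let eqtrunc_mulS k f f' g g' :
  in_maxideal f -> in_maxideal f' -> in_maxideal g -> in_maxideal g' ->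
  eqtrunc k f f' -> eqtrunc k g g' -> eqtrunc k.+1 (f * g) (f' * g').
Proof.
move=> f0 f'0 g0 g'0 ff gg m mk; rewrite !fpsME.
apply: eq_bigr => -[/= b1 b2] /eqP/(congr1 mdeg); rewrite mdegD => mb.
have [/eqP b10|b1p] := posnP (mdeg b1).
  by move: b10; rewrite mdeg_eq0 => /eqP ->; rewrite f0 f'0 !mul0r.
have [/eqP b20|b2p] := posnP (mdeg b2).
  by move: b20; rewrite mdeg_eq0 => /eqP ->; rewrite g0 g'0 !mulr0.
have b12k : (mdeg b1 + mdeg b2 <= k)%N by rewrite -[X in (X <= _)%N]mb -ltnS.
rewrite ff ?gg //; apply: leq_trans b12k.
  by rewrite -[X in (X < _)%N]add0n ltn_add2r.
by rewrite -[X in (X < _)%N]addn0 ltn_add2l.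
Qed.

Let monom_eqtrunc k F G m : (forall i, eqtrunc k (F i) (G i)) ->
  eqtrunc k (\prod_i F i ^+ m i) (\prod_i G i ^+ m i).
Proof.
move=> FG; elim/big_ind2: _ => // [f f' g g'|i _]; first exact: eqtrunc_mul.
by elim: (m i) => [//|j IH]; rewrite !exprS; apply: eqtrunc_mul.
Qed.

Let monom_eqtruncS k F G m : vanish F -> vanish G ->
  (forall i, eqtrunc k (F i) (G i)) -> (1 < mdeg m)%N ->
  eqtrunc k.+1 (\prod_i F i ^+ m i) (\prod_i G i ^+ m i).
Proof.
move=> F0 G0 FG m1.
have [i mi] : exists i, m i != 0%N.
  apply/existsP; apply: contraTT m1; rewrite negb_exists => /forallP m0.
  by rewrite mdegE big1 // => i _; apply/eqP; rewrite -[_ == _]negbK.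
have em : m = mnm1 i +m mnm_sub m (mnm1 i) by rewrite addmC submK ?lep1mP.
have m'1 : (0 < mdeg (mnm_sub m (mnm1 i)))%N.
  by move: m1; rewrite {1}em mdegD mdeg1.
have prodE (H : 'I_n -> fps n K) :
    \prod_i H i ^+ m i = H i * \prod_j H j ^+ (mnm_sub m (mnm1 i)) j.
  rewrite {1}em -[LHS]/(mmap1 H _) commr_mmap1_M ?mmap1U // => ? ?.
  exact: mulrC.
have vanishM (H : 'I_n -> fps n K) : vanish H ->
    in_maxideal (\prod_j H j ^+ (mnm_sub m (mnm1 i)) j).
  by move=> H0; apply: (order_monom H0); rewrite mdeg0.
by rewrite !prodE; apply: eqtrunc_mulS; auto; exact: monom_eqtrunc.
Qed.

Let comp_eqtruncS k f F G : order_ge 2 f -> vanish F -> vanish G ->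
  (forall i, eqtrunc k (F i) (G i)) -> eqtrunc k.+1 (fps_comp f F) (fps_comp f G).
Proof.
move=> f2 F0 G0 FG m mk /=; apply: eq_bigr => b _.
have [b2|b2] := ltnP (mdeg b) 2; first by rewrite f2 // !mul0r.
by congr (_ * _); apply: (@monom_eqtruncS k).
Qed.

Lemma comp_inv_ex (F : 'I_n -> fps n K) : vanish F -> jacobian F \in unitmx ->
  exists2 G : 'I_n -> fps n K, vanish G & forall i, fps_comp (F i) G = fpsX i.
Proof.
move=> F0 FU; pose A := jacobian F; pose r i := F i - lin (F i).
pose T (G : 'I_n -> fps n K) j := \sum_i invmx A j i *: (fpsX i - fps_comp (r i) G).
have r2 i : order_ge 2 (r i) by apply: lin_rest.
have r0 i : in_maxideal (r i) by apply: r2; rewrite mdeg0.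
have T0 G : vanish G -> vanish (T G).
  move=> G0 j; rewrite /in_maxideal fps_sumE big1 // => i _.
  by rewrite fpsZE fpsBE fpsX_maxideal comp_maxideal // subrr mulr0.
have TS k G H : vanish G -> vanish H -> (forall i, eqtrunc k (G i) (H i)) ->
    forall j, eqtrunc k.+1 (T G j) (T H j).
  move=> G0 H0 GH j m mk; rewrite !fps_sumE; apply: eq_bigr => i _.
  by rewrite !fpsZE !fpsBE (comp_eqtruncS (r2 i) G0 H0 GH).
pose it k := iter k T (fun=> 0).
have it0 k : vanish (it k) by elim: k => [//|k IH]; apply: T0.
have itS k i : eqtrunc k (it k i) (it k.+1 i).
  by elim: k i => [//|k IH] i; apply: (TS k (it k) (it k.+1)).
have itD k d i : eqtrunc k (it k i) (it (d + k)%N i).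
  elim: d => [//|d IH]; apply: (eqtrunc_trans IH) => m mk.
  by rewrite addSn itS // ltn_addl.
pose G i : fps n K := FPS (fun m => it (mdeg m).+1 i m).
have G0 : vanish G by move=> i; apply: it0.
have Git k i : eqtrunc k (G i) (it k i).
  by move=> m mk /=; rewrite -[in RHS](subnK mk); apply: (itD (mdeg m).+1 _ i m).
have GT j : G j = T G j.
  by apply: fpsP => m; rewrite (@TS (mdeg m) G (it (mdeg m))).
exists G => // i; rewrite -{1}[F i](subrK (lin (F i))) compD comp_lin //.
suff -> : \sum_l F i (mnm1 l) *: G l = fpsX i - fps_comp (r i) G by rewrite addrC subrK.
transitivity (\sum_l \sum_j (A i l * invmx A l j) *: (fpsX j - fps_comp (r j) G)).
  apply: eq_bigr => l _; rewrite [in LHS]GT scaler_sumr.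
  by apply: eq_bigr => j _; rewrite scalerA mxE.
rewrite exchange_big (bigD1 i) //= [X in _ + X]big1 => [|j ji]; rewrite -scaler_suml.
  have /matrixP/(_ i i) := mulmxV FU; rewrite mxE => ->.
  by rewrite mxE eqxx scale1r addr0.
have /matrixP/(_ i j) := mulmxV FU; rewrite mxE => ->.
by rewrite mxE eq_sym (negPf ji) scale0r.
Qed.

End Fps.

Section Diffeo.
Variables (n : nat) (K : fieldType).

Definition is_diffeo (F : {ffun 'I_n -> fps n K}) :=
  [forall i, F i mnm0 == 0] && (jacobian F \in unitmx).

Record diffeo := Diffeo {
  dcoord :> {ffun 'I_n -> fps n K};
  _ : is_diffeo dcoord }.

HB.instance Definition _ := [isSub for dcoord].
HB.instance Definition _ := [Choice of diffeo by <:].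

Implicit Types F G H : diffeo.

Lemma diffeo_maxideal F i : in_maxideal (F i).
Proof. by case: F => F /= /andP[/forallP/(_ i)/eqP]. Qed.

Lemma diffeo_unit F : jacobian F \in unitmx.
Proof. by case: F => F /= /andP[]. Qed.

Hint Resolve diffeo_maxideal diffeo_unit : core.

Fact diffeo_subproof (F : 'I_n -> fps n K) :
  (forall i, in_maxideal (F i)) -> jacobian F \in unitmx -> is_diffeo (finfun F).
Proof.
move=> F0 FU; apply/andP; split; first by apply/forallP => i; rewrite ffunE F0.
by congr (_ \in unitmx): FU; apply/matrixP => i j; rewrite !mxE ffunE.
Qed.

Definition mk_diffeo (f : 'I_n -> fps n K) (f0 : forall i, in_maxideal (f i))
  (fU : jacobian f \in unitmx) : diffeo := Diffeo (diffeo_subproof f0 fU).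

Lemma mk_diffeoE f f0 fU i : @mk_diffeo f f0 fU i = f i.
Proof. by rewrite ffunE. Qed.

Lemma diffeoP F G : F =1 G -> F = G.
Proof. by move=> FG; apply/val_inj/ffunP. Qed.

Definition diffeo_id : diffeo.
Proof.
apply: (@mk_diffeo (@fpsX n K)); first exact: fpsX_maxideal.
by rewrite jacobian_id unitmx1.
Defined.

Definition diffeo_comp F G : diffeo.
Proof.
apply: (@mk_diffeo (fun i => fps_comp (F i) G)) => [i|].
  exact: comp_maxideal.
by rewrite jacobian_comp // unitmx_mul !diffeo_unit.
Defined.

Lemma diffeo_idE i : diffeo_id i = fpsX K i.
Proof. exact: mk_diffeoE. Qed.

Lemma diffeo_compE F G i : diffeo_comp F G i = fps_comp (F i) G.
Proof. exact: mk_diffeoE. Qed.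

Lemma eq_comp (g : fps n K) (F G : 'I_n -> fps n K) : F =1 G -> fps_comp g F = fps_comp g G.
Proof. by move=> /funext ->. Qed.

Lemma comp_diffeoM (g : fps n K) F G :
  fps_comp g (diffeo_comp F G) = fps_comp (fps_comp g F) G.
Proof. by rewrite (eq_comp _ (diffeo_compE F G)) compA. Qed.

Lemma comp_diffeo1 (g : fps n K) : fps_comp g diffeo_id = g.
Proof. by rewrite (eq_comp _ diffeo_idE) comp_id. Qed.

Fact diffeo_compA : associative diffeo_comp.
Proof. by move=> F G H; apply: diffeoP => i; rewrite !diffeo_compE comp_diffeoM. Qed.

Fact diffeo_comp1 : right_id diffeo_id diffeo_comp.
Proof. by move=> F; apply: diffeoP => i; rewrite diffeo_compE comp_diffeo1. Qed.

Fact diffeo_1comp : left_id diffeo_id diffeo_comp.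
Proof. by move=> F; apply: diffeoP => i; rewrite diffeo_compE diffeo_idE comp_fpsX. Qed.

Fact diffeo_inv_ex F : exists G, diffeo_comp F G = diffeo_id.
Proof.
have [G G0 FG] := comp_inv_ex (diffeo_maxideal F) (diffeo_unit F).
have GU : jacobian G \in unitmx.
  have : jacobian F *m jacobian G \in unitmx.
    rewrite -jacobian_comp //; have -> : (fun i => fps_comp (F i) G) = @fpsX n K by apply: funext.
    by rewrite jacobian_id unitmx1.
  by rewrite unitmx_mul => /andP[].
exists (mk_diffeo G0 GU); apply: diffeoP => i.
by rewrite diffeo_compE diffeo_idE -FG; apply: eq_comp; apply: mk_diffeoE.
Qed.

Definition diffeo_inv F := sval (cid (diffeo_inv_ex F)).

Fact diffeo_compV : right_inverse diffeo_id diffeo_inv diffeo_comp.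
Proof. by move=> F; rewrite /diffeo_inv; case: cid. Qed.

Fact diffeo_Vcomp : left_inverse diffeo_id diffeo_inv diffeo_comp.
Proof.
move=> F; rewrite -[LHS]diffeo_comp1 -(diffeo_compV (diffeo_inv F)).
by rewrite diffeo_compA -(diffeo_compA _ F) diffeo_compV diffeo_comp1.
Qed.

HB.instance Definition _ := isGroup.Build diffeo
  diffeo_compA diffeo_1comp diffeo_comp1 diffeo_Vcomp diffeo_compV.

End Diffeo.

Definition gexpz (G : groupType) (x : G) (r : int) : G :=
  match r with
  | Posz k => (x ^+ k)%g
  | Negz k => (x ^- k.+1)%g
  end.

Definition zpowers (G : groupType) (x : G) : set G := range (gexpz x).

Section VectorField.
Variables (n : nat) (K : fieldType).

Definition fps_deriv (j : 'I_n) (g : fps n K) : fps n K :=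
  FPS (fun m => (m j).+1%:R * g (m +m mnm1 j)).

(* X = \sum_j a_j d/dx_j, represented by the tuple of its coefficients a_j *)
Record vfield := VField {
  vcoef :> {ffun 'I_n -> fps n K};
  _ : [forall j, vcoef j mnm0 == 0] }.

HB.instance Definition _ := [isSub for vcoef].
HB.instance Definition _ := [Choice of vfield by <:].

Definition vapp (X : vfield) (g : fps n K) : fps n K :=
  \sum_j X j * fps_deriv j g.

Lemma vapp_is_additive X : {morph vapp X : f g / f + g}.
Proof.
move=> f g; rewrite /vapp -big_split /=; apply: eq_bigr => j _; rewrite -mulrDr.
by congr (_ * _); apply: fpsP => m; rewrite fpsDE /= mulrDr.
Qed.

Lemma vappZ X c g : vapp X (c *: g) = c *: vapp X g.
Proof.
rewrite /vapp scaler_sumr; apply: eq_bigr => j _; apply: fpsP => m.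
rewrite !(fpsME, fpsZE) mulr_sumr; apply: eq_bigr => b _ /=.
by rewrite [X in _ * X = _]mulrCA [LHS]mulrCA.
Qed.

Lemma vapp_trunc X k f g : eqtrunc k f g -> eqtrunc k (vapp X f) (vapp X g).
Proof.
move=> fg m mk; rewrite !fps_sumE; apply: eq_bigr => j _; rewrite !fpsME.
apply: eq_bigr => -[/= b1 b2] /eqP/(congr1 mdeg); rewrite mdegD => mb.
have [/eqP|b1p] := posnP (mdeg b1).
  rewrite mdeg_eq0 => /eqP ->; case: X => X /= /forallP/(_ j)/eqP ->.
  by rewrite !mul0r.
rewrite fg // mdegD mdeg1 addn1; apply: leq_ltn_trans mk.
by rewrite [leqRHS]mb -[X in (X < _)%N]add0n ltn_add2r.
Qed.

End VectorField.

Section Jets.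
Variables (n : nat) (K : fieldType) (k : nat).
Implicit Types (f g : fps n K) (F : diffeo n K) (X : vfield n K).

(* m/m^(k+1) is identified with row vectors by means of its basis formed by the
   classes of the monomials of degree 1, ..., k. *)
Definition jet_monoms := [set b : bmultinom n k.+1 | (0 < mdeg b)%N]%SET.
Definition jet_dim := #|jet_monoms|.
Definition jet_monom (i : 'I_jet_dim) : multinom n := enum_val i.

(* The class of f in m/m^(k+1), for f in m. *)
Definition jet f : 'rV[K]_jet_dim := \row_i f (jet_monom i).

(* The polynomial representative of a class. *)
Definition jet_lift (v : 'rV[K]_jet_dim) : fps n K :=
  \sum_i v 0 i *: fps_monom K (jet_monom i).

(* The matrices of f + m^(k+1) |-> f o F + m^(k+1) and of
   f + m^(k+1) |-> X(f) + m^(k+1), acting on row vectors from the right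
   (see [jet_comp] and [jet_vapp]). *)
Definition jet_diffeo F : 'M[K]_jet_dim :=
  lin1_mx (fun v => jet (fps_comp (jet_lift v) F)).
Definition jet_vfield X : 'M[K]_jet_dim :=
  lin1_mx (fun v => jet (vapp X (jet_lift v))).

Lemma jet_lift_jet f : in_maxideal f -> eqtrunc k.+1 (jet_lift (jet f)) f.
Proof.
move=> f0 m mk; rewrite fps_sumE; have [/eqP|mp] := posnP (mdeg m).
  rewrite mdeg_eq0 => /eqP m0; rewrite m0 f0 big1 // => i _; rewrite fpsZE /=.
  have : (0 < mdeg (jet_monom i))%N by have := enum_valP i; rewrite inE.
  by rewrite lt0n mdeg_eq0 => /negPf ->; rewrite mulr0.
have mJ : BMultinom mk \in jet_monoms by rewrite inE.
rewrite (bigD1 (enum_rank_in mJ (BMultinom mk))) // fpsZE mxE.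
have -> : jet_monom (enum_rank_in mJ (BMultinom mk)) = m.
  by rewrite /jet_monom enum_rankK_in.
rewrite /= eqxx mulr1 big1 ?addr0 // => i ik; rewrite /=.
case: eqP => [im|]; last by rewrite mulr0.
case/eqP: ik; apply: enum_val_inj; rewrite enum_rankK_in //; exact: val_inj.
Qed.

Let jet_lin1 (u : fps n K -> fps n K) f :
  {morph u : g h / g + h} -> (forall c g, u (c *: g) = c *: u g) ->
  (forall g h, eqtrunc k.+1 g h -> eqtrunc k.+1 (u g) (u h)) ->
  in_maxideal f -> jet (u f) = jet f *m lin1_mx (fun v => jet (u (jet_lift v))).
Proof.
move=> uD uZ uT f0; apply/rowP => j; rewrite !mxE.
have u0 : u 0 = 0 by rewrite -[X in u X](scale0r 0) uZ scale0r.
rewrite -(uT _ _ (jet_lift_jet f0)) ?bmdeg // /jet_lift (big_morph _ uD u0) fps_sumE.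
apply: eq_bigr => i _; rewrite uZ fpsZE !mxE; congr (_ * u _ _).
rewrite (bigD1 i) //= mxE !eqxx scale1r big1 ?addr0 // => l li.
by rewrite mxE (negPf li) andbF scale0r.
Qed.

Lemma jet_comp f F : in_maxideal f -> jet (fps_comp f F) = jet f *m jet_diffeo F.
Proof.
move=> f0; rewrite /jet_diffeo -(jet_lin1 (u := fun g => fps_comp g F)) // => [|c g|g h].
- exact: compD.
- exact: compZ.
- exact: comp_trunc.
Qed.

Lemma jet_vapp f X : in_maxideal f -> jet (vapp X f) = jet f *m jet_vfield X.
Proof.
move=> f0; rewrite /jet_vfield -(jet_lin1 (u := vapp X)) // => [|c g|g h].
- exact: vapp_is_additive.
- exact: vappZ.
- exact: vapp_trunc.
Qed.

End Jets.

Arguments jet {n K} k f.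
Arguments jet_diffeo {n K} k F.
Arguments jet_vfield {n K} k X.

Section Zariski.
Variables (K : fieldType) (d : nat).
Implicit Types (S H : set 'M[K]_d) (A B : 'M[K]_d).

Definition mxeval A (p : mpoly (d * d) K) : K := meval (mxvec A 0) p.

Definition zvanish S (p : mpoly (d * d) K) := forall A, S A -> mxeval A p = 0.

(* Zariski closure in GL_d; multiplying by powers of det reduces to
   polynomials in the entries alone. *)
Definition zclosure S : set 'M[K]_d :=
  [set A | A \in unitmx /\ forall p, zvanish S p -> mxeval A p = 0].

(* The Lie algebra of an algebraic subgroup H of GL_d, i.e. its tangent space at
   the identity: the differential at 1 of any p vanishing on H is zero on B. *)
Definition lie_alg H : set 'M[K]_d :=
  [set B | forall p, zvanish H p ->
     \sum_i mxeval 1%:M (mderiv i p) * mxvec B 0 i = 0].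

End Zariski.

(* For a group G of formal diffeomorphisms, [pro_closure G] is the group
   consisting of the F whose k-jets belong to the Zariski closure G_k of the
   k-jets of G for all k >= 1, and [pro_lie G] is its Lie algebra. *)
Section ProAlgebraic.
Variables (n : nat) (K : fieldType) (G : set (diffeo n K)).
Local Open Scope classical_set_scope.

Definition jet_closure k := zclosure (jet_diffeo k @` G).
Arguments jet_closure k _ : clear implicits.

Definition pro_closure : set (diffeo n K) :=
  [set F | forall k, (0 < k)%N -> jet_closure k (jet_diffeo k F)].

Definition pro_lie : set (vfield n K) :=
  [set X | forall k, (0 < k)%N -> lie_alg (jet_closure k) (jet_vfield k X)].

End ProAlgebraic.

Section Generators.
Variables (R : realType) (n : nat).
Local Notation C := R[i].
Implicit Types (F : diffeo n C) (X : vfield n C) (I : set (fps n C)).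
Local Open Scope classical_set_scope.

(* F = Exp(X), that is, g o F = \sum_j X^j(g) / j! for all g.  The series
   converges coefficientwise in the complex numbers. *)
Definition is_exp X F := forall (g : fps n C) m,
  (fun N => \sum_(j < N) iter j (vapp X) g m / j`!%:R : C^o) @ \oo
    --> (fps_comp g F m : C^o).

Definition inf_generator X F := is_exp X F /\ pro_lie (zpowers F) X.

Definition embed_index F k :=
  [/\ (0 < k)%N,
      exists X, inf_generator X (F ^+ k)%g
    & forall l, (0 < l)%N -> (exists X, inf_generator X (F ^+ l)%g) -> (k <= l)%N].

Definition is_ideal I :=
  [/\ I 0, forall f g, I f -> I g -> I (f + g) & forall a f, I f -> I (a * f)].

Definition invariant_diffeo I F := [set fps_comp g F | g in I] `<=` I.
Definition invariant_vfield I X := vapp X @` I `<=` I.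

End Generators.

(* Main.v *)
Require Import Defs.
From mathcomp Require Import all_boot all_order all_algebra.
From mathcomp Require Import complex.
From mathcomp Require Import all_classical all_reals.
From mathcomp Require Import zify.
From mathcomp Require mpoly.
Import -(notations) mpoly.
From mathcomp Require Import topology normedtype sequences.
Import numFieldNormedType.Exports.
Import Order.TTheory GRing.Theory Num.Theory.

Set Implicit Arguments.
Unset Strict Implicit.
Unset Printing Implicit Defensive.

Local Open Scope ring_scope.

(* All ideals of C[[x_1, ..., x_n]] are closed in the m-adic topology, so that
   invariance of I can be tested on the subspaces of m/m^(k+1) formed by the jets
   of the elements of I (if I contains a unit there is nothing to prove).  These
   subspaces are closed for coefficientwise convergence, so that invariance for X
   passes to Exp(X).  Conversely, if the jets of I are stable under some F^r, then
   A = pi_k(F^m) satisfies: the stabilizer H of the jets of I contains A^|r|, so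
   it meets <A> in a subgroup of finite index.  A linear equation of H times
   equations of the other cosets, nonzero at 1, vanishes on <A>; its differential
   at 1 shows that the Lie algebra of the Zariski closure of <A> stabilizes the
   jets of I, and this Lie algebra contains the k-jet of X. *)

(** * Dickson's lemma for multi-indices *)

(** Each chosen index is one where [v] attains its minimum over the remaining tail, so all later
    values are at least as large. *)
Lemma nondecreasing_subseq (v : nat -> nat) :
  exists phi : nat -> nat, {homo phi : i j / (i < j)%N} /\
    {homo v \o phi : i j / (i <= j)%N}.
Proof.
have /choice[mn mnP] N : exists j, (N <= j)%N /\ forall i, (N <= i)%N -> (v j <= v i)%N.
  have ex : exists x, `[< exists2 j, (N <= j)%N & v j = x >].
    by exists (v N); apply/asboolP; exists N.
  have [_ /asboolP[j Nj <-] jmin] := ex_minnP ex.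
  by exists j; split=> // i Ni; apply: jmin; apply/asboolP; exists i.
pose phi := fix phi k := if k is k'.+1 then mn (phi k').+1 else mn 0%N.
have phiS k : (phi k < phi k.+1)%N by have [] := mnP (phi k).+1.
exists phi; split; first exact: homo_ltn ltn_trans phiS.
apply: homo_leq => [? //|? ? ?|k]; first exact: leq_trans.
rewrite /=; case: k => [|k]; first by apply: (mnP 0%N).2.
by apply: (mnP (phi k).+1).2; exact: ltn_trans (phiS k) (phiS k.+1).
Qed.

(** The coordinates are treated one after the other: a subsequence monotone in the coordinates of
    [s] stays so after the extraction for [l]. *)
Lemma multinom_subseq (n : nat) (u : nat -> multinom n) :
  exists phi : nat -> nat, {homo phi : i j / (i < j)%N} /\
    forall i j l, (i <= j)%N -> (u (phi i) l <= u (phi j) l)%N.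
Proof.
suff [phi [phi_inc phiP]] : exists phi : nat -> nat, {homo phi : i j / (i < j)%N} /\
    forall l, l \in enum 'I_n -> forall i j, (i <= j)%N -> (u (phi i) l <= u (phi j) l)%N.
  by exists phi; split=> // i j l; apply: (phiP l); rewrite mem_enum.
elim: (enum 'I_n) => [|l s [phi [phi_inc phiP]]]; first by exists id; split.
have [psi [psi_inc psiP]] := nondecreasing_subseq (fun k => u (phi k) l).
exists (phi \o psi); split=> [i j ij|l']; first exact/phi_inc/psi_inc.
rewrite inE => /orP[/eqP -> i j|l's i j]; first exact: psiP.
by rewrite leq_eqVlt => /orP[/eqP -> //|ij]; apply: phiP; rewrite // ltnW // psi_inc.
Qed.

(** Otherwise, picking forever an element of [E] that no earlier pick divides gives a sequence that
    contradicts [multinom_subseq]. *)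
Lemma multinom_dickson (n : nat) (E : multinom n -> Prop) :
  exists s : seq (multinom n), (forall a, a \in s -> E a) /\
    forall b, E b -> exists2 a, a \in s & lem a b.
Proof.
apply: contrapT => /forallNP noE.
have /choice[next nextP] (s : seq (multinom n)) : exists b,
    (forall a, a \in s -> E a) -> E b /\ forall a, a \in s -> ~~ lem a b.
  have [sE|] := pselect (forall a, a \in s -> E a); last by exists mnm0.
  have /not_andP[//|/existsNP[b /not_implyP[Eb nb]]] := noE s.
  by exists b => _; split=> // a a_s; apply/negP => ab; apply: nb; exists a.
pose pre := fix pre k := if k is k'.+1 then next (pre k') :: pre k' else [::].
have preE k a : a \in pre k -> E a.
  elim: k a => [//|k IH] a; rewrite inE => /orP[/eqP ->|/IH//].
  by have [] := nextP _ IH.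
have pre_in i j : (i < j)%N -> next (pre i) \in pre j.
  elim: j => [//|j IH]; rewrite ltnS leq_eqVlt inE => /orP[/eqP -> |/IH ->].
    by rewrite eqxx.
  by rewrite orbT.
have [phi [phi_inc phiP]] := multinom_subseq (fun k => next (pre k)).
have [_ /(_ _ (pre_in _ _ (phi_inc 0%N 1%N isT)))/negP] := nextP _ (preE (phi 1%N)).
by apply; apply/mnm_lepP => l; apply: phiP.
Qed.

(** * Stabilizers of subspaces and the Lie algebra of the closure of a cyclic group *)

Section LieStable.
Variables (K : fieldType) (d : nat).

(** The linear form [A |-> u A v], written as a polynomial in the entries of [A]. *)
Definition lform (u : 'rV[K]_d) (v : 'cV[K]_d) : mpoly (d * d) K :=
  \sum_k mxvec (\matrix_(i < d, j < d) (u 0 i * v j 0)) 0 k *: mpolyX K (mnm1 k).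

(** The differential of [p] at the identity in the direction [B], the expression that [lie_alg]
    requires to vanish. *)
Definition diff1 (B : 'M[K]_d) (p : mpoly (d * d) K) : K :=
  \sum_i mxeval 1%:M (mderiv i p) * mxvec B 0 i.

Lemma lform_sum (u : 'rV[K]_d) (v : 'cV[K]_d) (A : 'M[K]_d) :
  \sum_k mxvec (\matrix_(i < d, j < d) (u 0 i * v j 0)) 0 k * mxvec A 0 k = (u *m A *m v) 0 0.
Proof.
rewrite (reindex _ (curry_mxvec_bij _ _)) /=.
transitivity (\sum_(p : 'I_d * 'I_d) u 0 p.1 * v p.2 0 * A p.1 p.2).
  by apply: eq_bigr => -[i j] _; rewrite !mxvecE mxE.
rewrite -(pair_bigA _ (fun i j => u 0 i * v j 0 * A i j)) /= exchange_big mxE.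
apply: eq_bigr => j _; rewrite mxE mulr_suml.
by apply: eq_bigr => i _; rewrite mulrAC.
Qed.

Lemma mxeval_lform u v A : mxeval A (lform u v) = (u *m A *m v) 0 0.
Proof.
rewrite -lform_sum /mxeval /lform raddf_sum; apply: eq_bigr => k _ /=.
by rewrite mevalZ mevalXU.
Qed.

Lemma diff1_lform u v B : diff1 B (lform u v) = (u *m B *m v) 0 0.
Proof.
rewrite -lform_sum /diff1; apply: eq_bigr => k _; congr (_ * _).
rewrite /lform raddf_sum /mxeval raddf_sum (bigD1 k) //= big1 => [|i ik].
  rewrite mderivZ mderivX mevalZ mevalZ mevalX big1 ?addr0 => [|i _].
    by rewrite mnm1E eqxx !mulr1.
  by rewrite mnmBE subnn expr0.
by rewrite mderivZ mderivX mnm1E (negPf ik) scale0r scaler0 meval0.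
Qed.

Lemma diff1M B p q : diff1 B (p * q) =
  diff1 B p * mxeval 1%:M q + mxeval 1%:M p * diff1 B q.
Proof.
rewrite /diff1 mulr_suml mulr_sumr -big_split; apply: eq_bigr => i _ /=.
rewrite mderivM /mxeval mevalD !rmorphM /=.
by rewrite mulrDl -!mulrA [meval _ q * _]mulrC.
Qed.

Lemma lie_algP S B p : lie_alg (zclosure S) B -> zvanish S p -> diff1 B p = 0.
Proof. by move=> SB Sp; apply: SB => A [_]; apply. Qed.

(** The columns of the cokernel are linear equations of the row space; both the passage to the limit
    and the differentiation below act on these equations. *)
Lemma sub_mxP (u : 'rV[K]_d) (V : 'M[K]_d) :
  (u <= V)%MS <-> forall j, (u *m col j (cokermx V)) 0 0 = 0.
Proof.
rewrite submxE; split=> [/eqP uV j|uV]; first by rewrite colE mulmxA uV mul0mx mxE.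
by apply/eqP/rowP => j; have := uV j; rewrite colE mulmxA -colE !mxE.
Qed.

Lemma stablemx_rowP (V A : 'M[K]_d) :
  stablemx V A <-> forall i j, (row i V *m A *m col j (cokermx V)) 0 0 = 0.
Proof.
split=> [VA i|VA]; first by apply/sub_mxP; rewrite -row_mul (submx_trans (row_sub _ _) VA).
by apply/row_subP => i; rewrite row_mul; apply/sub_mxP.
Qed.

(** An invertible [A] preserves the rank, so the inclusion of [V A] in [V] is an equality, to which
    [A'] can be applied. *)
Lemma stablemx_inv (V A A' : 'M[K]_d) :
  A *m A' = 1%:M -> stablemx V A -> stablemx V A'.
Proof.
move=> AA' VA; have [AU _] := mulmx1_unit AA'.
have [_ /esym] := mxrank_leqif_eq VA; rewrite mxrankMfree ?row_free_unit // eqxx.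
by case/andP=> _ VVA; rewrite (submx_trans (submxMr _ VVA)) // -mulmxA AA' mulmx1.
Qed.

Variables (gT : groupType) (rho : gT -> 'M[K]_d).
Hypotheses (rho1 : rho 1%g = 1%:M) (rhoM : {morph rho : x y / (x * y)%g >-> x *m y}).

Lemma stablemx_group1 (V : 'M[K]_d) : stablemx V (rho 1%g).
Proof. by rewrite rho1 mulmx1. Qed.

Lemma stablemx_groupM (V : 'M[K]_d) x y :
  stablemx V (rho x) -> stablemx V (rho y) -> stablemx V (rho (x * y)%g).
Proof. by rewrite rhoM; apply: stablemxM. Qed.

Lemma stablemx_groupV (V : 'M[K]_d) x : stablemx V (rho x) -> stablemx V (rho x^-1%g).
Proof. by apply: stablemx_inv; rewrite -rhoM mulgV. Qed.

Lemma stablemx_groupX (V : 'M[K]_d) x k : stablemx V (rho x) -> stablemx V (rho (x ^+ k)%g).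
Proof.
move=> Vx; elim: k => [|k IH]; first exact: stablemx_group1.
by rewrite expgS; apply: stablemx_groupM.
Qed.

Lemma zpowers_stablemx_coset (V : 'M[K]_d) x r z : (0 < r)%N -> zpowers x z ->
  stablemx V (rho (x ^+ r)%g) ->
  exists2 i, (i < r)%N & stablemx V (rho (x ^- i * z)%g).
Proof.
move=> r0 [[k|k] _ <-] Vxr /=.
  exists (k %% r)%N; first exact: ltn_pmod.
  have -> : (x ^- (k %% r) * x ^+ k = (x ^+ r) ^+ (k %/ r))%g.
    by rewrite {2}(divn_eq k r) addnC expgnDr mulKg mulnC expgnA.
  exact: stablemx_groupX.
(* This is the residue of -(k+1) modulo r. *)
exists (r.-1 - k %% r)%N; first by rewrite (leq_ltn_trans (leq_subr _ _)) // prednK.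
have -> : (x ^- (r.-1 - k %% r) * x ^- k.+1 = ((x ^+ r) ^+ (k %/ r).+1)^-1)%g.
  rewrite -invgM -expgnDr -expgnA; congr (x ^- _)%g.
  have := ltn_pmod k r0; rewrite {1}(divn_eq k r); nia.
exact/stablemx_groupV/stablemx_groupX.
Qed.

(* A linear form [A |-> u A v] vanishing on the stabilizer of [V], times linear
   forms that vanish on the cosets of the stabilizer meeting [zpowers x] other
   than the stabilizer itself and not at 1, vanishes on [zpowers x]. *)
Lemma lie_alg_stablemx (V : 'M[K]_d) x r B : (0 < r)%N ->
  stablemx V (rho (x ^+ r)%g) -> lie_alg (zclosure (rho @` zpowers x)) B ->
  stablemx V B.
Proof.
move=> r0 Vxr lieB; apply/stablemx_rowP => i j.
have /choice[q qP] (l : nat) : exists q, mxeval 1%:M q != 0 /\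
    (~ stablemx V (rho (x ^+ l)%g) ->
     forall y, stablemx V (rho (x ^- l * y)%g) -> mxeval (rho y) q = 0).
  have [Vxl|nVxl] := pselect (stablemx V (rho (x ^+ l)%g)).
    (* When x^l stabilizes [V], the first factor of [p] already vanishes on its coset, so the factor
       1 suffices. *)
    by exists 1; rewrite /mxeval meval1 oner_neq0.
  have /existsNP[i' /existsNP[j' /eqP nz]] :
      ~ forall i j, (row i V *m rho (x ^- l)%g *m col j (cokermx V)) 0 0 = 0.
    by move/stablemx_rowP/stablemx_groupV; rewrite invgK.
  (* At 1 this form takes the nonzero value just found; at y it is an equation of the stabilizer
     evaluated at x^-l y. *)
  exists (lform (row i' V *m rho (x ^- l)%g) (col j' (cokermx V))).
  split=> [|_ y]; rewrite mxeval_lform; first by rewrite mulmx1.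
  by rewrite rhoM => /stablemx_rowP Vy; rewrite -[_ *m rho y]mulmxA.
pose p := lform (row i V) (col j (cokermx V)) * \prod_(l < r) q l.
have: diff1 B p = 0.
  apply: lie_algP lieB _ => _ [z xz <-].
  have [l lr Vz] := zpowers_stablemx_coset r0 xz Vxr.
  rewrite /mxeval rmorphM rmorph_prod /= -!/(mxeval _ _).
  have [Vxl|nVxl] := pselect (stablemx V (rho (x ^+ l)%g)); last first.
    by rewrite (bigD1 (Ordinal lr)) //= -/(mxeval _ _) (qP l).2 // mul0r mulr0.
  rewrite mxeval_lform; have := stablemx_groupM Vxl Vz; rewrite mulVKg.
  by move/stablemx_rowP ->; rewrite mul0r.
rewrite diff1M mxeval_lform mulmx1.
(* The linear form vanishes at 1, so Leibniz leaves its differential times the nonzero value of the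
   product at 1. *)
have /sub_mxP -> := row_sub i V; rewrite mul0r addr0 diff1_lform => /eqP.
rewrite mulf_eq0 /mxeval rmorph_prod => /orP[/eqP //|/prodf_eq0[l _]].
by have [/negPf] := qP l; rewrite /mxeval => ->.
Qed.

End LieStable.

(** * Division by a standard basis and closedness of ideals *)

Lemma fps_monomME (n : nat) (K : fieldType) (a : multinom n) (f : fps n K) m :
  (fps_monom K a * f) m = if lem a m then f (mnm_sub m a) else 0.
Proof.
rewrite fpsME; case: ifPn => [am|nam]; last first.
  rewrite big1 // => -[k1 k2] /= /eqP mk; case: eqP => [ak|_]; last by rewrite mul0r.
  by case/negP: nam; rewrite mk ak lem_addr.
have em := submK am; have /eqP := congr1 mdeg em; rewrite mdegD => /eqP dm.
have ha : (mdeg a < (mdeg m).+1)%N by rewrite ltnS -dm leq_addl.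
have hb : (mdeg (mnm_sub m a) < (mdeg m).+1)%N by rewrite ltnS -dm leq_addr.
rewrite (bigD1 (BMultinom ha, BMultinom hb)) /=; last by rewrite addmC em.
rewrite eqxx mul1r big1 ?addr0 // => -[k1 k2] /= /andP[/eqP mk nk].
case: eqP => [ak|_]; last by rewrite mul0r.
case/eqP: nk; congr (_, _); apply: val_inj => //=.
by rewrite [X in mnm_sub X _]mk ak addmC addmK.
Qed.

Lemma eqtruncD (n : nat) (K : fieldType) k (f f' g g' : fps n K) :
  eqtrunc k f f' -> eqtrunc k g g' -> eqtrunc k (f + g) (f' + g').
Proof. by move=> ff gg m mk; rewrite !fpsDE ff ?gg. Qed.

Lemma eqtruncB (n : nat) (K : fieldType) k (f f' g g' : fps n K) :
  eqtrunc k f f' -> eqtrunc k g g' -> eqtrunc k (f - g) (f' - g').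
Proof. by move=> ff gg m mk; rewrite !fpsBE ff ?gg. Qed.

Lemma eqtrunc_sum (n : nat) (K : fieldType) k J (r : seq J) (P : pred J)
    (f f' : J -> fps n K) : (forall j, P j -> eqtrunc k (f j) (f' j)) ->
  eqtrunc k (\sum_(j <- r | P j) f j) (\sum_(j <- r | P j) f' j).
Proof. by move=> ff; elim/big_ind2: _ => // *; apply: eqtruncD. Qed.

Section ClosedIdeal.
Variables (n : nat) (K : fieldType) (I : set (fps n K)).
Hypotheses (I0 : I 0) (ID : forall f g, I f -> I g -> I (f + g))
  (IM : forall a f, I f -> I (a * f)).

Lemma idealZ c f : I f -> I (c *: f).
Proof. by move=> If; rewrite -[f]mul1r scalerAl; apply: IM. Qed.

Lemma idealB f g : I f -> I g -> I (f - g).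
Proof. by move=> If Ig; rewrite -scaleN1r; apply/ID/idealZ. Qed.

Lemma ideal_sum J (r : seq J) (P : pred J) (f : J -> fps n K) :
  (forall j, P j -> I (f j)) -> I (\sum_(j <- r | P j) f j).
Proof. by move=> If; elim/big_ind: _. Qed.

Definition adherent (g : fps n K) := forall k, exists2 f, I f & eqtrunc k f g.

Lemma adherentB g f : adherent g -> I f -> adherent (g - f).
Proof.
move=> gI If k; have [f' If' f'g] := gI k.
by exists (f' - f); [exact: idealB | exact: eqtruncB].
Qed.

(** The order on multi-indices compares degrees first, so the initial exponent sits in lowest
    degree, as suits power series. *)
Definition initial (f : fps n K) (a : multinom n) :=
  f a != 0 /\ forall b : multinom n, (b < a)%O -> f b = 0.

Section Division.
Variables (s : seq (multinom n)) (f : multinom n -> fps n K) (D : nat).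
Hypotheses (s_uniq : uniq s) (fI : forall a, a \in s -> I (f a))
  (f_init : forall a, a \in s -> initial (f a) a)
  (s_deg : forall a, a \in s -> (mdeg a <= D)%N)
  (s_basis : forall g b, I g -> initial g b -> exists2 a, a \in s & lem a b).

(** Adherence suffices: an element of [I] close enough to [g] has the same initial exponent, hence
    one divisible by some [a] in [s]. Dividing by the initial term of [f a] lowers the order by at
    most [D], a loss independent of [k]; this makes the quotients summable in [division]. *)
Lemma division_step k g : adherent g -> eqtrunc k g 0 ->
  exists p : multinom n -> fps n K, (forall a, eqtrunc (k - D) (p a) 0) /\
    eqtrunc k.+1 g (\sum_(a <- s) p a * f a).
Proof.
(* The coefficients of degree k are cleared one after the other, in increasing
   order; [supp h] shrinks each time. *)
pose supp (h : fps n K) := [set b : bmultinom n k.+1 |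
  [exists c : bmultinom n k.+1, (bmnm c <= bmnm b)%O && (h c != 0)]]%SET.
have [N] := ubnP #|supp g|; elim: N g => [//|N IH] g.
rewrite ltnS => gN gI g_ord.
have [[b0 gb0]|g0] := pselect (exists b : bmultinom n k.+1, g b != 0); last first.
  exists (fun=> 0); split=> // m mk; rewrite fps_sumE big1 => [|a _]; last by rewrite mul0r.
  by apply/eqP/negPn/negP => gm; apply: g0; exists (BMultinom mk).
have [b gb bmin] : exists2 b : bmultinom n k.+1, g b != 0 &
    forall c : bmultinom n k.+1, g c != 0 -> (bmnm b <= bmnm c)%O.
  by case: (@arg_minP _ _ _ b0 (fun c => g (bmnm c) != 0) (@bmnm n k.+1) gb0) => b; exists b.
have bk := bmdeg b; have kb : (k <= mdeg b)%N.
  by rewrite leqNgt; apply/negP => /g_ord gb'; rewrite gb' eqxx in gb.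
have g_lt m : (m < bmnm b)%O -> g m = 0.
  move=> mb; have mk : (mdeg m < k.+1)%N by rewrite (leq_ltn_trans _ bk) // lemc_mdeg // ltW.
  apply/eqP/negPn/negP => /(bmin (BMultinom mk)) /=; by rewrite leNgt mb.
have [f' If' f'g] := gI k.+1.
have f'_init : initial f' b.
  split=> [|c cb]; first by rewrite f'g.
  by rewrite f'g ?g_lt // (leq_ltn_trans _ bk) // lemc_mdeg // ltW.
have [a a_s ab] := s_basis If' f'_init; have [fa fa0] := f_init a_s.
pose t := (g b / f a a) *: fps_monom K (mnm_sub b a); pose g' := g - t * f a.
have tfE m : (t * f a) m = g b / f a a *
    (if lem (mnm_sub b a) m then f a (mnm_sub m (mnm_sub b a)) else 0).
  by rewrite /t -scalerAl fpsZE fps_monomME.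
have g'_le m : (m <= bmnm b)%O -> g' m = 0.
  rewrite fpsBE tfE le_eqVlt => /orP[/eqP ->|mb].
    rewrite lem_subr.
    have -> : mnm_sub b (mnm_sub b a) = a by rewrite -{1}(submK ab) addmC addmK.
    by rewrite divfK // subrr.
  rewrite g_lt // sub0r; case: ifP => [bam|]; last by rewrite mulr0 oppr0.
  (* Cancelling b - a in m < b puts m - (b - a) below the initial exponent a. *)
  rewrite [f a (mnm_sub m _)]fa0 ?mulr0 ?oppr0 //.
  by rewrite -(@ltmc_add2r _ (mnm_sub b a)) submK // addmC submK.
have g'I : adherent g' by apply: adherentB => //; apply/IM/fI.
have g'_ord : eqtrunc k g' 0.
  move=> m mk; apply: g'_le; apply/ltW/lt_mdeg_ltmc; exact: leq_trans kb.
have [|//|//|p [p_ord pP]] := IH g' _.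
  (* [supp] is the upward closure of the support: the subtraction may create coefficients, but only
     above b, so the closure does not grow and loses b. *)
  apply: leq_trans gN; apply: proper_card; apply/properP; split; last first.
    exists b; rewrite inE; first by apply/existsP; exists b; rewrite lexx.
    apply/negP => /existsP[c /andP[/g'_le ->]]; by rewrite eqxx.
  apply/fintype.subsetP => c; rewrite !inE => /existsP[c' /andP[c'c g'c']].
  apply/existsP; exists b; rewrite gb andbT (le_trans _ c'c) //.
  by rewrite leNgt; apply/negP => /ltW/g'_le g'0; rewrite g'0 eqxx in g'c'.
exists (fun c => p c + if c == a then t else 0); split=> [c m mk|].
  rewrite fpsDE p_ord // add0r; case: eqP => // _; rewrite fpsZE /=.
  case: eqP => [mE|]; last by rewrite mulr0.
  have := congr1 mdeg (submK ab); rewrite mdegD mE; have := s_deg a_s.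
  by move: mk kb; clear; lia.
rewrite -[g](subrK (t * f a)) -/g'.
have -> : \sum_(c <- s) (p c + if c == a then t else 0) * f c =
    \sum_(c <- s) p c * f c + t * f a.
  under eq_bigr do rewrite mulrDl; rewrite big_split /=; congr (_ + _).
  by rewrite (bigD1_seq a) //= eqxx big1 ?addr0 // => c /negPf ->; rewrite mul0r.
exact: eqtruncD.
Qed.

Lemma division g : adherent g -> exists q : multinom n -> fps n K,
  g = \sum_(a <- s) q a * f a.
Proof.
move=> gI; have /choice[P PP] (kh : nat * fps n K) : exists p : multinom n -> fps n K,
    adherent kh.2 -> eqtrunc kh.1 kh.2 0 -> (forall a, eqtrunc (kh.1 - D) (p a) 0) /\
    eqtrunc kh.1.+1 kh.2 (\sum_(a <- s) p a * f a).
  have [[hI h_ord]|nh] := pselect (adherent kh.2 /\ eqtrunc kh.1 kh.2 0).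
    by have [p pP] := division_step hI h_ord; exists p.
  by exists (fun=> 0) => hI h_ord; case: nh; split.
pose h := fix h k := if k is k'.+1
  then h k' - \sum_(a <- s) P (k', h k') a * f a else g.
have hP k : adherent (h k) /\ eqtrunc k (h k) 0.
  elim: k => [//|k [hI h_ord]] /=; have [_ hP] := PP (k, h k) hI h_ord.
  split; first by apply: adherentB => //; rewrite big_seq; apply: ideal_sum => a /fI/IM.
  by rewrite -[X in eqtrunc _ _ X](subrr (\sum_(a <- s) P (k, h k) a * f a)); apply: eqtruncB.
pose p k := P (k, h k).
have p_ord k a : eqtrunc (k - D) (p k a) 0 by have [pP _] := PP (k, h k) (hP k).1 (hP k).2; apply: pP.
have gE k : g = h k + \sum_(a <- s) (\sum_(j < k) p j a) * f a.
  elim: k => [|k {1}->].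
    by rewrite big1 ?addr0 // => a _; rewrite big_ord0 mul0r.
  under [in RHS]eq_bigr do rewrite big_ord_recr mulrDl.
  by rewrite big_split /= addrCA [X in _ = _ + X]subrK addrC.
(* Since [p j a] has order at least j - D, the terms with j > deg m + D do not contribute to the
   coefficient of index m. *)
exists (fun a => FPS (fun m => \sum_(j < (mdeg m).+1 + D) p j a m)).
apply: eqtruncP => k; rewrite [X in eqtrunc _ X](gE (k + D)%N) -[X in eqtrunc _ _ X]add0r.
apply: eqtruncD; first by move=> m mk; rewrite (hP _).2 // ltn_addr.
apply: eqtrunc_sum => a _; apply: eqtrunc_mul => // m mk /=; rewrite fps_sumE.
rewrite -(big_mkord xpredT (fun j => p j a m)) -(big_mkord xpredT (fun j => p j a m)).
rewrite (@big_cat_nat _ _ _ ((mdeg m).+1 + D)) ?leq_add2r //=.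
rewrite [X in _ + X]big_nat_cond [X in _ + X]big1 ?addr0 // => j /andP[/andP[mj _] _].
by rewrite p_ord // ltn_subRL addnC.
Qed.

End Division.

(* Krull's theorem that the ideals of K[[x_1, ..., x_n]] are closed in the
   m-adic topology, by means of a standard basis. *)
Lemma ideal_closed g : adherent g -> I g.
Proof.
have [s0 [s0E s0_basis]] := multinom_dickson (fun a => exists2 f, I f & initial f a).
pose s := undup s0.
have /choice[f fP] (a : multinom n) : exists f, a \in s -> I f /\ initial f a.
  have [|_] := boolP (a \in s); last by exists 0.
  by rewrite mem_undup => /s0E[f If fa]; exists f.
move=> gI; have [|||||q ->] := @division s f (\max_(a <- s) mdeg a) _ _ _ _ _ g gI.
- exact: undup_uniq.
- by move=> a /fP[].
- by move=> a /fP[].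
- by move=> a a_s; rewrite (big_rem a) //= leq_maxl.
- move=> h b Ih hb; have [|a] := s0_basis b; first by exists h.
  by rewrite -mem_undup; exists a.
by rewrite big_seq; apply: ideal_sum => a /fP[fI _]; apply: IM.
Qed.

End ClosedIdeal.

(** Among the matrices with row space inside [Q], one of maximal rank works: adjoining a vector of
    [Q] cannot raise its rank. *)
Lemma rowspace_of_closed (K : fieldType) d (Q : 'rV[K]_d -> Prop) :
  Q 0 -> (forall u v, Q u -> Q v -> Q (u + v)) -> (forall c v, Q v -> Q (c *: v)) ->
  exists V : 'M[K]_d, forall v, Q v <-> (v <= V)%MS.
Proof.
move=> Q0 QD QZ; pose sub (V : 'M[K]_d) := forall v : 'rV_d, (v <= V)%MS -> Q v.
have ex : exists r, `[< exists2 V, sub V & \rank V = r >].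
  exists 0%N; apply/asboolP; exists 0; last exact: mxrank0.
  by move=> v; rewrite submx0 => /eqP ->.
have [|r /asboolP[V VQ <-] Vmax] := ex_maxnP ex (m := d).
  by move=> r /asboolP[V _ <-]; apply: rank_leq_row.
exists V => v; split=> [Qv|]; last exact: VQ.
have /mxrank_leqif_sup[_ /esym] := addsmxSl V v.
suff -> : \rank V == \rank (V + v)%MS by apply: submx_trans (addsmxSr _ _).
rewrite eqn_leq mxrankS ?addsmxSl //=; apply: Vmax; apply/asboolP.
exists (V + v)%MS => // w /sub_addsmxP[[a b] -> /=]; apply: QD.
  exact/VQ/submxMl.
by rewrite [b]mx11_scalar mul_scalar_mx; apply: QZ.
Qed.

(** * The representation of formal diffeomorphisms on jets *)

Section JetRepresentation.
Variables (n : nat) (K : fieldType) (k : nat).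

Lemma jet_lift_maxideal (v : 'rV[K]_(jet_dim n k)) : in_maxideal (jet_lift v).
Proof.
rewrite /in_maxideal fps_sumE big1 // => i _; rewrite fpsZE /=.
have : (0 < mdeg (jet_monom i))%N by have := enum_valP i; rewrite inE.
by rewrite lt0n mdeg_eq0 => /negPf ->; rewrite mulr0.
Qed.

Lemma jet_liftK (v : 'rV[K]_(jet_dim n k)) : jet k (jet_lift v) = v.
Proof.
apply/rowP => i; rewrite mxE fps_sumE (bigD1 i) //= eqxx mulr1 big1 ?addr0 // => j ji.
rewrite -[_ == _]/(bmnm (enum_val j) == bmnm (enum_val i)) val_eqE.
by rewrite (inj_eq enum_val_inj) (negPf ji) mulr0.
Qed.

Lemma jet_mulmx_inj (A B : 'M[K]_(jet_dim n k)) :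
  (forall f : fps n K, in_maxideal f -> jet k f *m A = jet k f *m B) -> A = B.
Proof.
move=> AB; apply/row_matrixP => i; rewrite !rowE -(jet_liftK (delta_mx 0 i)).
exact/AB/jet_lift_maxideal.
Qed.

Lemma jet_diffeo1 : jet_diffeo k (1%g : diffeo n K) = 1%:M.
Proof.
by apply: jet_mulmx_inj => f f0; rewrite -jet_comp // comp_diffeo1 mulmx1.
Qed.

Lemma jet_diffeoM : {morph @jet_diffeo n K k : F G / (F * G)%g >-> F *m G}.
Proof.
move=> F G; apply: jet_mulmx_inj => f f0; rewrite mulmxA -!jet_comp //.
  by rewrite comp_diffeoM.
by apply: comp_maxideal => // i; apply: diffeo_maxideal.
Qed.

Lemma eq_jet (f g : fps n K) : in_maxideal f -> in_maxideal g ->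
  jet k f = jet k g -> eqtrunc k.+1 f g.
Proof.
move=> f0 g0 fg; apply: eqtrunc_trans (eqtrunc_sym (jet_lift_jet f0)) _.
by rewrite fg; apply: jet_lift_jet.
Qed.

End JetRepresentation.

Lemma vapp0 (n : nat) (K : fieldType) (X : vfield n K) : vapp X 0 = 0.
Proof. by rewrite -[0 in LHS](scale0r 0) vappZ scale0r. Qed.

Lemma vapp_maxideal (n : nat) (K : fieldType) (X : vfield n K) f :
  in_maxideal f -> in_maxideal (vapp X f).
Proof.
move=> f0; rewrite /in_maxideal (@vapp_trunc _ _ X 1 f 0) ?vapp0 ?mdeg0 //.
exact: order_ge1.
Qed.

(** * The subspaces of jets of an ideal *)

Section Invariance.
Variables (R : realType) (n : nat) (I : set (fps n R[i])).
Hypothesis hI : is_ideal I.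

Let I0 : I 0. Proof. by case: hI. Qed.
Let ID f g : I f -> I g -> I (f + g). Proof. by case: hI => _ + _; apply. Qed.
Let IM a f : I f -> I (a * f). Proof. by case: hI => _ _; apply. Qed.

(* If f is in I and f(0) = c, then 1 - (1 - f/c)^k is in I and congruent to 1
   modulo m^k; as I is closed, it contains 1. *)
Lemma ideal_full f g : I f -> f mnm0 != 0 -> I g.
Proof.
move=> If f0; suff I1 : I 1 by rewrite -[g]mulr1; apply: IM.
apply: ideal_closed => // k; pose u := 1 - (f mnm0)^-1 *: f.
have u0 : in_maxideal u by rewrite /in_maxideal fpsBE fpsZE mulVf //= eqxx mulr1 subrr.
have uE : 1 - u = (f mnm0)^-1 *: f by rewrite subKr.
exists (1 - u ^+ k).
  by rewrite -opprB subrX1 -mulNr opprB uE mulrC; apply: IM; apply: idealZ.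
rewrite -[X in eqtrunc _ _ X]subr0; apply: eqtruncB => //; exact: order_geX.
Qed.

Lemma ideal_maxideal f : I f -> ~ I 1 -> in_maxideal f.
Proof. by move=> If I1; apply/eqP/negPn/negP => /(ideal_full 1 If). Qed.

Variable k : nat.

(** A matrix encodes the subspace so that invariance becomes [stablemx]. As [jet] does not see the
    constant term, its vanishing is demanded separately. *)
Lemma ideal_jets_ex : exists V : 'M[R[i]]_(jet_dim n k), forall v,
  (exists f, [/\ I f, in_maxideal f & jet k f = v]) <-> (v <= V)%MS.
Proof.
apply: rowspace_of_closed => [|_ _ [f [If f0 <-]] [g [Ig g0 <-]]|c _ [f [If f0 <-]]].
- by exists 0; split=> //; apply/rowP => i; rewrite !mxE.
- exists (f + g); split; first exact: ID.
    by rewrite /in_maxideal fpsDE f0 g0 addr0.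
  by apply/rowP => i; rewrite !mxE.
- exists (c *: f); split; first by apply: idealZ.
    by rewrite /in_maxideal fpsZE f0 mulr0.
  by apply/rowP => i; rewrite !mxE.
Qed.

Definition ideal_jets := sval (cid ideal_jets_ex).

Lemma ideal_jetsP v :
  (exists f, [/\ I f, in_maxideal f & jet k f = v]) <-> (v <= ideal_jets)%MS.
Proof. exact: (svalP (cid ideal_jets_ex)). Qed.

Lemma ideal_jets_mem f : I f -> in_maxideal f -> (jet k f <= ideal_jets)%MS.
Proof. by move=> If f0; apply/ideal_jetsP; exists f. Qed.

Lemma ideal_jets_diffeo (F : diffeo n R[i]) : invariant_diffeo I F ->
  stablemx ideal_jets (jet_diffeo k F).
Proof.
move=> IF; apply/row_subP => i; rewrite row_mul.
have /ideal_jetsP[f [If f0 <-]] := row_sub i ideal_jets.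
rewrite -jet_comp //; apply: ideal_jets_mem; first by apply: IF; exists f.
by apply: comp_maxideal => // j; apply: diffeo_maxideal.
Qed.

End Invariance.

Lemma ideal_of_jets (R : realType) (n : nat) (I : set (fps n R[i])) (hI : is_ideal I)
    (g : fps n R[i]) : in_maxideal g ->
  (forall k, (0 < k)%N -> (jet k g <= ideal_jets hI k)%MS) -> I g.
Proof.
move=> g0 gV; case: (hI) => I0 ID IM; apply: ideal_closed => // k.
(* The shift to k+1 covers k = 0, for which no jet condition is given. *)
have /ideal_jetsP[f [If f0 fg]] := gV k.+1 isT.
exists f => // m mk; apply: (eq_jet f0 g0 fg); exact: leq_trans mk (leqW (leqnSn _)).
Qed.

(** * The implications between the invariance properties *)

(** The partial sums of the exponential series applied to [f] lie in [I]. The linear equations of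
    the jets of [I] vanish on them, and each involves finitely many coefficients, so they hold in
    the limit. *)
Lemma invariant_exp (R : realType) (n : nat) (I : set (fps n R[i])) (hI : is_ideal I)
    (X : vfield n R[i]) (F : diffeo n R[i]) :
  is_exp X F -> invariant_vfield I X -> invariant_diffeo I F.
Proof.
move=> XF IX _ [f If <-]; case: (hI) => I0 ID IM.
have [I1|I1] := pselect (I 1); first by rewrite -[fps_comp _ _]mulr1; apply: IM.
have Im := fun g (Ig : I g) => ideal_maxideal hI Ig I1.
apply: (@ideal_of_jets _ _ _ hI).
  by apply: comp_maxideal => [|i]; [exact: Im | exact: diffeo_maxideal].
move=> k _; apply/sub_mxP => j.
pose S N := \sum_(l < N) (l`!%:R^-1 : R[i]) *: iter l (vapp X) f.
have SI N : I (S N).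
  apply: ideal_sum => // l _; apply: idealZ => //.
  by elim: (nat_of_ord l) => [//|l' IH]; apply: IX; exists (iter l' (vapp X) f).
set c := col j _; set y := jet k (fps_comp f F).
have cvS : ((fun N => (jet k (S N) *m c) 0 0 : R[i]^o) @ \oo --> ((y *m c) 0 0 : R[i]^o))%classic.
  rewrite mxE; under eq_cvg do rewrite mxE.
  apply: cvg_big => [|i _]; first exact: add_continuous.
  apply: cvgMr_tmp; rewrite mxE; under eq_cvg do rewrite mxE fps_sumE.
  apply: cvg_trans (XF f (jet_monom i)).
  by apply: near_eq_cvg; near=> N; apply: eq_bigr => l _; rewrite fpsZE mulrC.
have S0 : (fun N => (jet k (S N) *m c) 0 0 : R[i]^o) = fun=> 0.
  apply/funext => N; have /sub_mxP := ideal_jets_mem hI k (SI N) (Im _ (SI N)).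
  exact.
by move: cvS; rewrite S0 => /(cvg_unique (@norm_hausdorff _ _)); apply; apply: cvg_cst.
Unshelve. all: by end_near. Qed.

Lemma invariant_of_iterate (R : realType) (n : nat) (I : set (fps n R[i])) (hI : is_ideal I)
    (F : diffeo n R[i]) (m : nat) (X : vfield n R[i]) (r : int) :
  pro_lie (zpowers (F ^+ m)%g) X -> r != 0 -> invariant_diffeo I (gexpz F r) ->
  invariant_vfield I X.
Proof.
move=> lieX r0 IF _ [f If <-]; case: (hI) => I0 ID IM.
have [I1|I1] := pselect (I 1); first by rewrite -[vapp _ _]mulr1; apply: IM.
have f0 : in_maxideal f by apply: ideal_maxideal If I1.
apply: (@ideal_of_jets _ _ _ hI) => [|k k0]; first exact: vapp_maxideal.
rewrite jet_vapp //; apply: submx_trans (submxMr _ (ideal_jets_mem hI k If f0)) _.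
have rho1 := jet_diffeo1 n R[i] k; have rhoM := @jet_diffeoM n R[i] k.
apply: (lie_alg_stablemx rho1 rhoM (r := `|r|%N) _ _ (lieX k k0)).
  by rewrite absz_gt0.
(* The |r|-th power of F^m is the m-th power of F^|r|, and F^|r| stabilizes the jets because F^r or
   its inverse does. *)
rewrite expgnAC; apply: (stablemx_groupX rho1 rhoM).
have := ideal_jets_diffeo hI k IF; case: r {r0 IF} => //= r.
by move/(stablemx_groupV rho1 rhoM); rewrite invgK.
Qed.

Theorem proposition4p20 (R : realType) (n : nat) (F : diffeo n R[i]) (m : nat)
    (hm : embed_index F m) (X : vfield n R[i]) (hX : inf_generator X (F ^+ m)%g)
    (I : set (fps n R[i])) (hI : is_ideal I) :
  [<-> invariant_vfield I X;
       invariant_diffeo I (F ^+ m)%g;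
       exists r : int, r != 0 /\ invariant_diffeo I (gexpz F r)].
Proof.
have [XF lieX] := hX; split; [|split].
- exact: invariant_exp.
(* The iterate F^m itself is non-trivial, an index of embeddability being positive. *)
- by move=> IF; exists m%:Z; split=> //; have [m0] := hm; case: m m0 {hm hX XF lieX IF}.
- by case=> r [r0]; apply: invariant_of_iterate lieX r0.
Qed.
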